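(* For every $M\ge 1$ there is a constant $C(M)$ such that the following holds. Let $A\subset\mathbb{R}$ be a finite set and let $D=A-A$. If $|DD|\le M|D|$ or $|D/D|\le M|D|$, then $|A|\le C(M)$.
   Context: For finite $X,Y\subset\mathbb{R}$: $X-Y=\{x-y: x\in X,\,y\in Y\}$, $XY=\{xy: x\in X,\,y\in Y\}$, $X/Y=\{x/y: x\in X,\,y\in Y,\,y\ne 0\}$. $|\cdot|$ denotes cardinality. *)

(* Defs.v *)
From mathcomp Require Import all_boot all_order all_algebra finmap.
From mathcomp Require Import reals.

Set Implicit Arguments.
Unset Strict Implicit.
Unset Printing Implicit Defensive.

Import Order.TTheory GRing.Theory Num.Theory.
Local Open Scope fset_scope.
Local Open Scope ring_scope.

Definition diffset (R : realType) (X Y : {fset R}) : {fset R} :=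
  [fset x - y | x in X, y in Y].

Definition prodset (R : realType) (X Y : {fset R}) : {fset R} :=
  [fset x * y | x in X, y in Y].

(* In MathComp x / 0 = 0, so the denominator 0 has to be discarded
   explicitly. *)
Definition quotset (R : realType) (X Y : {fset R}) : {fset R} :=
  [fset x / y | x in X, y in Y & y != 0].

(* Main.v *)
Require Import Defs.
From mathcomp Require Import all_boot all_order all_algebra finmap.
From mathcomp Require Import reals.
From mathcomp Require Import ring lra zify.

Set Implicit Arguments.
Unset Strict Implicit.
Unset Printing Implicit Defensive.
Import Order.TTheory GRing.Theory Num.Theory.
Local Open Scope fset_scope.
Local Open Scope ring_scope.

(* Let P be the set of positive elements of D. The hypothesis says that P has
   small multiplicative doubling, or small ratio set, so by the
   Pluennecke-Ruzsa inequality |P^4 / P^3| <= C |P| <= C |A|^2. Conversely,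
   split A into a lower part p_0 < ... < p_2m and an upper part
   b_0 < ... < b_r with m, r of order |A|, and set phi_i(q) = (b_(i+1) - q) / (b_i - q), which
   increases with q. The points (b_i - p_2m) phi_i(p_2k) bound m disjoint
   subintervals of [b_i - p_2m, b_(i+1) - p_2m), and such a subinterval receives the
   product of its left end by every u in P^2 / P^2 with
   1 <= u < phi_i(p_(2k+2)) / phi_i(p_2k). For fixed k, if fewer than L such u
   exist, then the cross ratios of (b_i, b_(i+1)) with (p_2k, p_(2k+1)) and
   with (p_(2k+1), p_(2k+2)) are both among the L smallest elements of
   P^2 / P^2 that are at least 1, and these two cross ratios determine i: so
   this happens for at most L^2 indices i. Hence
   |P^4 / P^3| >= m L (r - L^2), which contradicts the upper bound when L and
   then |A| are large. *)

(** * Membership in product and quotient sets; cardinality tools *)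

Lemma prodset_mem (R : realType) (X Y : {fset R}) (x y : R) :
  x \in X -> y \in Y -> x * y \in prodset X Y.
Proof. by move=> xX yY; apply: in_imfset2. Qed.

Lemma prodsetP (R : realType) (X Y : {fset R}) (z : R) :
  reflect (exists x y, [/\ x \in X, y \in Y & z = x * y]) (z \in prodset X Y).
Proof.
apply: (iffP (imfset2P _ _ _ _ _)) => [[x /= xX [y /= yY ->]]|[x [y [xX yY ->]]]].
  by exists x, y.
by exists x => //; exists y.
Qed.

Lemma quotsetP (R : realType) (X Y : {fset R}) (z : R) :
  reflect (exists x y, [/\ x \in X, y \in Y, y != 0 & z = x / y])
    (z \in quotset X Y).
Proof.
apply: (iffP (imfset2P _ _ _ _ _)).
  by move=> [x /= xX [y]]; rewrite inE /= => /andP[yY y0] ->; exists x, y.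
by move=> [x [y [xX yY y0 ->]]]; exists x => //; exists y; rewrite // inE yY.
Qed.

Lemma prodsetA (R : realType) (X Y Z : {fset R}) :
  prodset X (prodset Y Z) = prodset (prodset X Y) Z.
Proof.
apply/fsetP => w; apply/prodsetP/prodsetP.
  move=> [x [_ [xX /prodsetP[y [z [yY zZ ->]]] ->]]].
  by exists (x * y), z; split; rewrite ?mulrA //; apply: prodset_mem.
move=> [_ [z [/prodsetP[x [y [xX yY ->]]] zZ ->]]].
by exists x, (y * z); split; rewrite ?mulrA //; apply: prodset_mem.
Qed.

Lemma leq_card_fset_inj (S T : choiceType) (f : S -> T) (A : {fset S})
    (B : {fset T}) :
  {in A &, injective f} -> (forall x, x \in A -> f x \in B) ->
  (#|` A| <= #|` B|)%N.
Proof.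
move=> finj fB; rewrite -(card_in_imfset imfset_key finj).
by apply: fsubset_leq_card; apply/fsubsetP => _ /imfsetP[x /= xA ->]; apply: fB.
Qed.

Lemma leq_card_fset_image (S T : choiceType) (f : S -> T) (A : {fset S}) :
  (#|` [fset f x | x in A]| <= #|` A|)%N.
Proof. exact: leq_imfset_card. Qed.

Lemma cardfs_prod (S T : choiceType) (A : {fset S}) (B : {fset T}) :
  #|` A `*` B| = (#|` A| * #|` B|)%N.
Proof.
have inj : {in [pred t : {_ : S & T} | (tag t \in A) && (tagged t \in B)] &,
  injective (fun t : {_ : S & T} => (tag t, tagged t))}.
  by move=> [x y] [x' y'] /= _ _ [-> ->].
by rewrite (perm_size (enum_imfset2 _ inj)) size_allpairs.
Qed.

(** * The Pluennecke-Ruzsa inequality for products, by Petridis' method *)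

(** Induction on the size of [X0]: either [X0] itself minimizes the ratio |ZB| / |Z| among its
    subsets, or a proper nonempty subset has a smaller ratio and the induction continues there.
    Ratios are cross-multiplied to stay in [nat]. *)
Lemma exists_ratio_minimizer (R : realType) (B X0 : {fset R}) :
  X0 != fset0 ->
  exists X : {fset R}, [/\ X != fset0, X `<=` X0,
    (#|` prodset X B| * #|` X0| <= #|` prodset X0 B| * #|` X|)%N &
    forall Z, Z `<=` X ->
      (#|` prodset X B| * #|` Z| <= #|` prodset Z B| * #|` X|)%N].
Proof.
move: {2}(#|` X0|) (leqnn #|` X0|) => n; elim: n X0 => [|n IHn] X0 cX0 X0n0.
  by move: cX0; rewrite leqn0 cardfs_eq0 (negPf X0n0).
have [/allP H|] := boolP (all (fun Z : {fset R} =>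
    #|` prodset X0 B| * #|` Z| <= #|` prodset Z B| * #|` X0|)%N (fpowerset X0)).
  by exists X0; split => // Z ZX; apply: H; rewrite fpowersetE.
move=> /allPn[Z]; rewrite fpowersetE -ltnNge => ZX0 ltZ.
have Zn0 : Z != fset0.
  by apply: contraTneq ltZ => ->; rewrite cardfs0 muln0.
have cZ : (#|` Z| < #|` X0|)%N.
  rewrite fproper_ltn_card // fproperEneq ZX0 andbT.
  by apply: contraTneq ltZ => ->; rewrite ltnn.
have [|X [Xn0 XZ ratX minX]] := IHn Z _ Zn0; first by rewrite -ltnS (leq_trans cZ).
exists X; split => //; first exact: fsubset_trans ZX0.
have Zpos : (0 < #|` Z|)%N by rewrite cardfs_gt0.
rewrite -(leq_pmul2r Zpos).
apply: (@leq_trans (#|` prodset Z B| * #|` X| * #|` X0|)).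
  by rewrite mulnAC leq_mul2r ratX orbT.
by rewrite [leqLHS]mulnAC [leqRHS]mulnAC leq_mul2r (ltnW ltZ) orbT.
Qed.

(* Petridis: adding an element c to C, the part of X B c coming from the
   elements x with x c in X C is already in X B C; minimality of the ratio
   bounds that part from below. *)
Lemma petridis (R : realType) (X B C : {fset R}) :
  0 \notin C ->
  (forall Z, Z `<=` X ->
    (#|` prodset X B| * #|` Z| <= #|` prodset Z B| * #|` X|)%N) ->
  (#|` prodset (prodset X B) C| * #|` X|
     <= #|` prodset X B| * #|` prodset X C|)%N.
Proof.
move=> C0 minX; elim/fset1U_rect: C C0 => [|c C cC IHC].
  suff -> : prodset (prodset X B) fset0 = fset0 by rewrite cardfs0.
  apply/eqP; rewrite -fsubset0; apply/fsubsetP => z /prodsetP[x [y []]].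
  by rewrite inE.
rewrite in_fset1U negb_or eq_sym => /andP[c0 /IHC{}IHC].
pose W := [fset x in X | x * c \in prodset X C].
have WX : W `<=` X by exact: fset_sub.
have WXB : prodset W B `<=` prodset X B.
  apply/fsubsetP => _ /prodsetP[x [y [xW yB ->]]].
  by apply: prodset_mem => //; apply: (fsubsetP WX).
have upper : (#|` prodset (prodset X B) (c |` C)| <=
    #|` prodset (prodset X B) C| + (#|` prodset X B| - #|` prodset W B|))%N.
  rewrite -cardfsDS //.
  pose V := [fset z * c | z in prodset X B `\` prodset W B].
  apply: (@leq_trans (#|` prodset (prodset X B) C| + #|` V|)); last first.
    by rewrite leq_add2l leq_card_fset_image.
  apply: leq_trans (leq_card_fsetU _ _); apply: fsubset_leq_card.
  apply/fsubsetP => z /prodsetP[w [d [wXB]]]; rewrite in_fset1U => dC ->.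
  rewrite in_fsetU; apply/orP; case/orP: dC => [/eqP ->|dC]; last first.
    by left; apply: prodset_mem.
  have [wWB|wWB] := boolP (w \in prodset W B); last first.
    by right; apply: in_imfset; rewrite inE wWB.
  left; case/prodsetP: wWB => x [b [xW bB ->]].
  move: xW; rewrite !inE /= => /andP[xX /prodsetP[x' [c' [x'X c'C e]]]].
  by rewrite mulrAC e mulrAC; apply: prodset_mem => //; apply: prodset_mem.
have lower : (#|` prodset X C| + (#|` X| - #|` W|) <= #|` prodset X (c |` C)|)%N.
  rewrite -cardfsDS //.
  have inj : {in X `\` W &, injective (fun x => x * c)}.
    by move=> x y _ _; apply: mulIf.
  rewrite -(card_in_imfset imfset_key inj) -cardfsUI.
  rewrite [X in (_ + #|` X|)%N](_ : _ = fset0) ?cardfs0 ?addn0.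
    apply: fsubset_leq_card; apply/fsubsetP => z; rewrite in_fsetU => /orP[].
      case/prodsetP=> x [d [xX dC ->]].
      by apply: prodset_mem; rewrite // in_fset1U dC orbT.
    case/imfsetP=> x /=; rewrite in_fsetD => /andP[_ xX] ->.
    by apply: prodset_mem; rewrite // in_fset1U eqxx.
  apply/eqP; rewrite -fsubset0; apply/fsubsetP => z; rewrite in_fsetI => /andP[zXC].
  case/imfsetP=> x /=; rewrite in_fsetD => /andP[xW xX] ez.
  by move: xW; rewrite !inE /= xX -ez zXC.
(* Minimality at [W] is equivalent to (|XB| - |WB|) |X| <= |XB| (|X| - |W|), which compares the
   increments in [upper] and [lower]. *)
have := minX W WX.
have := fsubset_leq_card WX; have := fsubset_leq_card WXB.
move: upper lower IHC => /=; nia.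
Qed.

Fixpoint prodpow (R : realType) (B : {fset R}) (k : nat) : {fset R} :=
  if k is k'.+1 then prodset B (prodpow B k') else [fset 1].

Lemma prodpowD (R : realType) (B : {fset R}) (j k : nat) (x y : R) :
  x \in prodpow B j -> y \in prodpow B k -> x * y \in prodpow B (j + k).
Proof.
elim: j x => [|j IHj] x /=; first by rewrite inE => /eqP -> yB; rewrite mul1r.
by case/prodsetP=> b [z [bB zB ->]] yB; rewrite -mulrA prodset_mem ?IHj.
Qed.

Lemma prodpow1 (R : realType) (B : {fset R}) (x : R) :
  x \in B -> x \in prodpow B 1.
Proof. by move=> xB; rewrite -[x]mulr1 prodset_mem // inE. Qed.

Lemma prodpow_inv (R : realType) (B : {fset R}) (k : nat) (x : R) :
  x \in prodpow B k -> x^-1 \in prodpow [fset b^-1 | b in B] k.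
Proof.
elim: k x => [|k IHk] x /=; first by rewrite !inE => /eqP ->; rewrite invr1.
case/prodsetP=> b [z [bB /IHk zB ->]]; rewrite invfM prodset_mem //.
exact: in_imfset.
Qed.

Lemma prodpow_neq0 (R : realType) (B : {fset R}) (k : nat) :
  0 \notin B -> 0 \notin prodpow B k.
Proof.
move=> B0; elim: k => [|k IHk] /=; first by rewrite inE eq_sym oner_eq0.
apply/negP => /prodsetP[b [z [bB zB /esym/eqP]]].
by rewrite mulf_eq0 => /orP[] /eqP e; move: B0 IHk; rewrite -{1}e ?bB -?e ?zB.
Qed.

(** With a fixed representation d = y / z for each quotient, the map (d, x) -> (x y, x z) is
    injective: the quotient of the coordinates returns d, hence z, and then x. *)
Lemma ruzsa_triangle (R : realType) (X Y Z : {fset R}) :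
  0 \notin X ->
  (#|` quotset Y Z| * #|` X| <= #|` prodset X Y| * #|` prodset X Z|)%N.
Proof.
move=> X0.
(* The default (0, 0) is reached only for [d] outside [quotset Y Z]. *)
pose rep (d : R) : R * R :=
  if [pick p : Y * Z | (val p.2 != 0) && (d == val p.1 / val p.2)]
  is Some p then (val p.1, val p.2) else (0, 0).
have repP d : d \in quotset Y Z ->
    [/\ (rep d).1 \in Y, (rep d).2 \in Z, (rep d).2 != 0 &
      d = (rep d).1 / (rep d).2].
  rewrite /rep; case: pickP => [[y z] /= /andP[z0 /eqP ->] _|no].
    by split => //; apply: valP.
  case/quotsetP => y [z [yY zZ z0 e]].
  by have := no ([` yY], [` zZ]); rewrite /= z0 e eqxx.
rewrite -!cardfs_prod.
apply: (@leq_card_fset_inj _ _ (fun w => (w.2 * (rep w.1).1, w.2 * (rep w.1).2))).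
  move=> [d x] [d' x']; rewrite !in_fsetM /= => /andP[/repP[_ _ z0 ed] xX].
  move=> /andP[/repP[_ _ z0' ed'] xX'] [e1 e2].
  have x0 : x != 0 by apply: contraNneq X0 => <-.
  have x0' : x' != 0 by apply: contraNneq X0 => <-.
  have dd : d = d'.
    rewrite ed ed' -[LHS]mul1r -[RHS]mul1r -{1}(divff x0) -(divff x0').
    by rewrite !mulf_div e1 e2.
  by move: e2; rewrite dd => /(mulIf z0') ->.
move=> [d x]; rewrite !in_fsetM /= => /andP[/repP[yY zZ _ _] xX].
by rewrite !prodset_mem.
Qed.

(** For a ratio minimizer X inside [X0], [petridis] with C = B^j gives |X B^j| <= K^j |X| by
    induction on j. The triangle inequality through X then bounds B^k / B^l by K^(k+l) |X|. *)
Lemma plunnecke (R : realType) (X0 B : {fset R}) (K k l : nat) :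
  X0 != fset0 -> 0 \notin X0 -> 0 \notin B ->
  (#|` prodset X0 B| <= K * #|` X0|)%N ->
  (#|` quotset (prodpow B k) (prodpow B l)| <= K ^ (k + l) * #|` X0|)%N.
Proof.
move=> X0n0 X00 B0 small.
have [X [Xn0 XX0 ratX minX]] := exists_ratio_minimizer B X0n0.
have X0gt : (0 < #|` X0|)%N by rewrite cardfs_gt0.
have Xgt : (0 < #|` X|)%N by rewrite cardfs_gt0.
have smallX : (#|` prodset X B| <= K * #|` X|)%N.
  rewrite -(leq_pmul2r X0gt); apply: leq_trans ratX _.
  by rewrite mulnAC leq_mul2r small orbT.
have powX j : (#|` prodset X (prodpow B j)| <= K ^ j * #|` X|)%N.
  elim: j => [|j IHj] /=.
    rewrite mul1n; apply: fsubset_leq_card; apply/fsubsetP => z.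
    by case/prodsetP => x [y [xX]]; rewrite inE => /eqP -> ->; rewrite mulr1.
  rewrite prodsetA -(leq_pmul2r Xgt).
  apply: leq_trans (petridis (prodpow_neq0 j B0) minX) _.
  by apply: leq_trans (leq_mul smallX IHj) _; rewrite mulnACA -expnS mulnA.
have X_0 : 0 \notin X by apply: contra X00; apply: (fsubsetP XX0).
rewrite -(leq_pmul2r Xgt); apply: leq_trans (ruzsa_triangle _ _ X_0) _.
apply: leq_trans (leq_mul (powX k) (powX l)) _.
rewrite mulnACA -expnD mulnA leq_mul2r leq_mul2l.
by rewrite (fsubset_leq_card XX0) !orbT.
Qed.

(** * Counting in half-open intervals *)

Definition count_in (R : realType) (W : {fset R}) (x y : R) : nat :=
  #|` [fset w in W | x <= w < y]|.

Lemma count_in_le (R : realType) (W : {fset R}) (x x' y y' : R) :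
  x' <= x -> y <= y' -> (count_in W x y <= count_in W x' y')%N.
Proof.
move=> xx yy; apply: fsubset_leq_card; apply/fsubsetP => w; rewrite !inE /=.
by move=> /and3P[-> /(le_trans xx) -> /lt_le_trans ->].
Qed.

Lemma count_in_cat (R : realType) (W : {fset R}) (x y z : R) :
  x <= y -> y <= z ->
  (count_in W x y + count_in W y z <= count_in W x z)%N.
Proof.
move=> xy yz; rewrite /count_in -cardfsUI.
rewrite [X in (_ + #|` X|)%N](_ : _ = fset0) ?cardfs0 ?addn0.
  apply: fsubset_leq_card; apply/fsubsetP => w; rewrite !inE /=.
  case/orP => /and3P[-> h1 h2]; first by rewrite h1 (lt_le_trans h2).
  by rewrite (le_trans xy h1) h2.
apply/eqP; rewrite -fsubset0; apply/fsubsetP => w; rewrite !inE /=.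
by move=> /andP[/and3P[_ _ wy] /and3P[_ yw _]]; rewrite ltNge yw in wy.
Qed.

Lemma sum_count_in (R : realType) (W : {fset R}) (x : nat -> R) (k : nat) :
  (forall i, (i < k)%N -> x i <= x i.+1) ->
  x 0%N <= x k /\
  (\sum_(i < k) count_in W (x i) (x i.+1) <= count_in W (x 0%N) (x k))%N.
Proof.
elim: k => [|k IHk] xle; first by rewrite big_ord0.
have [|x0k IH] := IHk; first by move=> i ik; apply: xle; apply: ltnW.
have xk := xle k (ltnSn k).
split; first exact: le_trans xk.
rewrite big_ord_recr /=; apply: leq_trans (count_in_cat W x0k xk).
by rewrite leq_add2r.
Qed.

(** This makes [count_in U x u] a strictly increasing rank on the elements of [U] from [x] on: [u]
    is counted below [v] but not below itself. *)
Lemma count_in_lt (R : realType) (U : {fset R}) (x u v : R) :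
  u \in U -> x <= u -> u < v -> (count_in U x u < count_in U x v)%N.
Proof.
move=> uU xu uv; apply: fproper_ltn_card; rewrite /fproper.
apply/andP; split.
  by apply/fsubsetP => w; rewrite !inE /= => /and3P[-> -> /lt_trans ->].
by apply/fsubsetPn; exists u; rewrite !inE /= uU xu ?uv ?ltxx.
Qed.

Lemma count_in_inj (R : realType) (U : {fset R}) (x : R) :
  {in [pred u in U | x <= u] &, injective (count_in U x)}.
Proof.
move=> u v; rewrite !inE => /andP[uU xu] /andP[vU xv] e.
by case: (ltgtP u v) => // /count_in_lt;
  [move=> /(_ _ _ uU xu)|move=> /(_ _ _ vU xv)]; rewrite e ltnn.
Qed.

(** * Cross ratios *)

(** This is phi(q) / phi(p) for phi(x) = (b - x) / (a - x). *)
Definition cross (R : realType) (a b p q : R) : R :=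
  ((b - q) * (a - p)) / ((a - q) * (b - p)).

(** Equality of the two cross ratios says that (b - x)(c - x) / ((a - x)(d - x)) takes the same
    value at p and at q. *)
Lemma cross_transfer (R : realType) (a b c d p q k : R) :
  p < q -> q < a -> a < b -> q < c -> c < d -> cross a b p q = cross c d p q ->
  (b - p) * (c - p) = k * ((a - p) * (d - p)) ->
  (b - q) * (c - q) = k * ((a - q) * (d - q)).
Proof.
move=> pq qa ab qc cd /eqP; rewrite eqr_div; last first.
- by rewrite mulf_neq0 // gt_eqF //; lra.
- by rewrite mulf_neq0 // gt_eqF //; lra.
move=> /eqP e kp; apply: (@mulfI _ ((a - p) * (d - p))).
  by rewrite mulf_neq0 // gt_eqF //; lra.
transitivity ((b - q) * (a - p) * ((c - q) * (d - p))); first by ring.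
rewrite e; transitivity ((b - p) * (c - p) * ((a - q) * (d - q))); first by ring.
by rewrite kp; ring.
Qed.

(* The hypotheses make the quadratic (b - x)(c - x) - k (a - x)(d - x) vanish
   at p, q and s, for a suitable k. *)
Lemma cross_inj (R : realType) (a b c d p q s : R) :
  p < q -> q < s -> s < a -> a < b -> s < c -> c < d ->
  cross a b p q = cross c d p q -> cross a b q s = cross c d q s -> a = c.
Proof.
move=> pq qs sa ab sc cd e1 e2.
pose k := ((b - p) * (c - p)) / ((a - p) * (d - p)).
have kp : (b - p) * (c - p) = k * ((a - p) * (d - p)).
  by rewrite divfK // mulf_neq0 // gt_eqF //; lra.
have kq : (b - q) * (c - q) = k * ((a - q) * (d - q)).
  by apply: cross_transfer kp => //; lra.
have ks : (b - s) * (c - s) = k * ((a - s) * (d - s)).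
  exact: cross_transfer kq.
move: kp kq ks; move: k => k kp kq ks.
(* [h1] and [h2] are divided differences of the quadratic at its roots; subtracting them kills its
   leading coefficient 1 - k. *)
have h1 : b + c - p - q = k * (a + d - p - q).
  by apply: (@mulfI _ (q - p)); [rewrite gt_eqF //; lra|lra].
have h2 : b + c - q - s = k * (a + d - q - s).
  by apply: (@mulfI _ (s - q)); [rewrite gt_eqF //; lra|lra].
have k1 : k = 1.
  by apply: (@mulfI _ (s - p)); [rewrite gt_eqF //; lra|lra].
(* With k = 1, the pairs (b, c) and (a, d) have equal sums and products, so a is b or c, and a <
   b. *)
have ed : d = b + c - a by move: h1; rewrite k1; lra.
have : (a - b) * (a - c) = 0 by move: kp; rewrite k1 ed; lra.
by move/eqP; rewrite mulf_eq0 => /orP[] /eqP; lra.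
Qed.

Lemma cross_mul (R : realType) (a b p q s : R) :
  p < q -> q < s -> s < a -> a < b ->
  cross a b p q * cross a b q s = cross a b p s.
Proof.
by move=> pq qs sa ab; rewrite /cross; field; do ?[apply/andP; split]; lra.
Qed.

Lemma cross_gt1 (R : realType) (a b p q : R) :
  p < q -> q < a -> a < b -> 1 < cross a b p q.
Proof.
move=> pq qa ab; rewrite /cross ltr_pdivlMr ?mul1r; last by rewrite mulr_gt0 //; lra.
by rewrite -subr_gt0 (_ : _ - _ = (b - a) * (q - p)) ?mulr_gt0 ?subr_gt0 //; ring.
Qed.

(* An exceptional row i is determined by the ranks in U, both less than L, of
   its two consecutive cross ratios. *)
Lemma few_small_cross (R : realType) (U : {fset R}) (p q s : R) (b : nat -> R)
    (r L : nat) :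
  p < q -> q < s -> s < b 0%N ->
  (forall i j, (i < j <= r)%N -> b i < b j) ->
  (forall i, (i < r)%N -> cross (b i) (b i.+1) p q \in U) ->
  (forall i, (i < r)%N -> cross (b i) (b i.+1) q s \in U) ->
  (#|[set i : 'I_r | count_in U 1 (cross (b i) (b i.+1) p s) < L]| <= L ^ 2)%N.
Proof.
move=> pq qs sb binc Upq Uqs; case: L => [|L].
  by rewrite leqn0 cards_eq0 -subset0; apply/subsetP => i; rewrite inE ltn0.
have sbi i : (i <= r)%N -> s < b i.
  by case: i => // i ir; apply: lt_trans sb _; apply: binc.
(* [inord] is faithful only on ranks below [L.+1], a bound supplied by [ranks]. *)
pose f (i : 'I_r) : 'I_L.+1 * 'I_L.+1 :=
  (inord (count_in U 1 (cross (b i) (b i.+1) p q)),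
   inord (count_in U 1 (cross (b i) (b i.+1) q s))).
rewrite -mulnn -{2 3}(card_ord L.+1) -card_prod; apply: (leq_card_in f).
(* Both consecutive cross ratios exceed 1 and their product is the one from p to s, so neither has a
   larger rank than the product. *)
have ranks i : (i < r)%N -> (count_in U 1 (cross (b i) (b i.+1) p s) < L.+1)%N ->
    (count_in U 1 (cross (b i) (b i.+1) p q) < L.+1)%N /\
    (count_in U 1 (cross (b i) (b i.+1) q s) < L.+1)%N.
  move=> ir; have sb1 := sbi i (ltnW ir);
  have bb : b i < b i.+1 by apply: binc; rewrite ltnSn.
  have g1 : 1 < cross (b i) (b i.+1) p q by apply: cross_gt1 => //; lra.
  have g2 : 1 < cross (b i) (b i.+1) q s by apply: cross_gt1.
  rewrite -(cross_mul pq qs sb1 bb) => lt.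
  split; apply: leq_ltn_trans lt; apply: count_in_le => //.
    by rewrite ler_peMr ?ltW //; lra.
  by rewrite ler_peMl ?ltW //; lra.
move=> i j; rewrite !inE => /(ranks _ (ltn_ord i))[i1 i2]
  /(ranks _ (ltn_ord j))[j1 j2].
move=> [] /(congr1 val) /=; rewrite !inordK // => e1 /(congr1 val) /=.
rewrite !inordK // => e2.
have si := sbi i (ltnW (ltn_ord i)); have sj := sbi j (ltnW (ltn_ord j)).
have bi : b i < b i.+1 by apply: binc; rewrite ltnSn ltn_ord.
have bj : b j < b j.+1 by apply: binc; rewrite ltnSn ltn_ord.
have gt1 k p' q' : (k < r)%N -> p' < q' -> q' <= s -> 1 <= cross (b k) (b k.+1) p' q'.
  move=> kr pq' qs'; apply/ltW/cross_gt1 => //; last by apply: binc; rewrite ltnSn.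
  by apply: le_lt_trans qs' _; apply: sbi; apply: ltnW.
have qs' := ltW qs.
have {}e1 : cross (b i) (b i.+1) p q = cross (b j) (b j.+1) p q.
  by apply: count_in_inj e1; rewrite inE Upq ?gt1.
have {}e2 : cross (b i) (b i.+1) q s = cross (b j) (b j.+1) q s.
  by apply: count_in_inj e2; rewrite inE Uqs ?gt1.
have bij := cross_inj pq qs si bi sj bj e1 e2.
by apply: val_inj => /=; case: (ltngtP i j) => // ij;
  have := binc _ _ (introT andP (conj ij (ltnW (ltn_ord _)))); rewrite bij ltxx.
Qed.

(** * The lower bound for P^4 / P^3 *)

Lemma many_quotients (R : realType) (P : {fset R}) (p b : nat -> R)
    (m r L : nat) :
  (forall i j, (i < j <= m.*2)%N -> p i < p j) ->
  (forall i j, (i < j <= r)%N -> b i < b j) ->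
  p m.*2 < b 0%N ->
  (forall i j, (i <= r)%N -> (j <= m.*2)%N -> b i - p j \in P) ->
  (m * L * (r - L ^ 2) <= #|` quotset (prodpow P 4) (prodpow P 3)|)%N.
Proof.
move=> pinc binc pb memP.
set W := quotset _ _; pose U := quotset (prodpow P 2) (prodpow P 2).
pose t := p m.*2.
have p_le j : (j <= m.*2)%N -> p j <= t.
  by rewrite leq_eqVlt => /orP[/eqP -> //|jm]; apply/ltW/pinc; rewrite jm leqnn.
have b_gt i : (i <= r)%N -> t < b i.
  by case: i => // i ir; apply: lt_trans pb _; apply: binc.
have bS i : (i < r)%N -> b i < b i.+1 by move=> ir; apply: binc; rewrite ltnSn.
have pS j : (j < m.*2)%N -> p j < p j.+1 by move=> ir; apply: pinc; rewrite ltnSn.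
have dif_gt0 i j : (i <= r)%N -> (j <= m.*2)%N -> 0 < b i - p j.
  by move=> ir jm; rewrite subr_gt0; apply: le_lt_trans (p_le _ jm) (b_gt _ ir).
have U_cross i j k : (i < r)%N -> (j <= m.*2)%N -> (k <= m.*2)%N ->
    cross (b i) (b i.+1) (p j) (p k) \in U.
  move=> ir jm km; have ir' := ltnW ir.
  apply/quotsetP; exists ((b i.+1 - p k) * (b i - p j)), ((b i - p k) * (b i.+1 - p j)).
  split; rewrite ?(prodpowD (j := 1) (k := 1)) ?prodpow1 ?memP //.
  by rewrite mulf_neq0 // gt_eqF ?dif_gt0.
(* The cut points of row i, (b_i - t) phi_i(p_j). *)
pose x i j := (b i - t) * ((b i.+1 - p j) / (b i - p j)).
have x_gt0 i j : (i < r)%N -> (j <= m.*2)%N -> 0 < x i j.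
  move=> ir jm; have ir' := ltnW ir.
  by rewrite mulr_gt0 ?divr_gt0 ?dif_gt0.
have x_cross i j k : (i < r)%N -> (j <= m.*2)%N -> (k <= m.*2)%N ->
    x i k = x i j * cross (b i) (b i.+1) (p j) (p k).
  move=> ir jm km; have ir' := ltnW ir.
  rewrite /x /cross; field.
  by rewrite !gt_eqF ?dif_gt0.
have x_le i j k : (i < r)%N -> (j < k)%N -> (k <= m.*2)%N -> x i j <= x i k.
  move=> ir jk km; have jm : (j <= m.*2)%N := leq_trans (ltnW jk) km.
  rewrite (x_cross i j k) // ler_peMr ?(ltW (x_gt0 _ _ _ _)) //.
  apply/ltW/cross_gt1; [by apply: pinc; rewrite jk | | exact: bS].
  by apply: le_lt_trans (p_le _ km) (b_gt _ (ltnW ir)).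
have U_W i j k : (i < r)%N -> (j < k)%N -> (k <= m.*2)%N ->
    (count_in U 1 (cross (b i) (b i.+1) (p j) (p k)) <= count_in W (x i j) (x i k))%N.
  move=> ir jk km; have jm : (j <= m.*2)%N := leq_trans (ltnW jk) km.
  have ir' := ltnW ir; have x0 := x_gt0 i j ir jm.
  apply: (@leq_card_fset_inj _ _ (fun u => x i j * u)).
    by move=> u v _ _; apply: mulfI; rewrite gt_eqF.
  move=> u; rewrite !inE => /and3P[/quotsetP[y [z [yP zP z0 ->]]] u1 u2].
  apply/and3P; split; last 2 first.
  - by rewrite ler_peMr // ltW.
  - by rewrite (x_cross i j k) // ltr_pM2l.
  (* [x i j] has two factors from P above and one below; u = y / z adds two on each side, whence P^4
     / P^3. *)
  apply/quotsetP; exists ((b i - t) * (b i.+1 - p j) * y), ((b i - p j) * z).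
  split; last by rewrite /x [X in X * _]mulrA mulf_div.
  - apply: (prodpowD (j := 2)) => //.
    by apply: (prodpowD (j := 1) (k := 1)); apply: prodpow1; apply: memP.
  - by apply: (prodpowD (j := 1)) => //; apply: prodpow1; apply: memP.
  - by rewrite mulf_neq0 // gt_eqF ?dif_gt0.
have W_row i : (i < r)%N ->
    (\sum_(k < m) count_in U 1 (cross (b i) (b i.+1) (p k.*2) (p k.+1.*2)) <=
     count_in W (b i - t) (b i.+1 - t))%N.
  move=> ir; have ir' := ltnW ir.
  have [|_ H] := @sum_count_in _ W (fun k => x i k.*2) m.
    by move=> k km; apply: x_le => //; lia.
  apply: leq_trans (leq_trans H _); first apply: leq_sum => k _.
    by apply: U_W => //; have := ltn_ord k; lia.
  apply: count_in_le.
    rewrite /x ler_peMr ?ltW ?subr_gt0 ?b_gt //.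
    by rewrite ltr_pdivlMr ?dif_gt0 // mul1r ltrD2r bS.
  (* As [t] is p_2m, the last cut of row i is exactly b_(i+1) - t. *)
  by rewrite /x -/t mulrCA divff ?mulr1 // gt_eqF ?subr_gt0 ?b_gt.
have W_all : (\sum_(i < r) \sum_(k < m)
    count_in U 1 (cross (b i) (b i.+1) (p k.*2) (p k.+1.*2)) <= #|` W|)%N.
  have [|_ H] := @sum_count_in _ W (fun i => b i - t) r.
    by move=> i ir; rewrite lerD2r ltW ?bS.
  apply: leq_trans (leq_trans H _); first by apply: leq_sum => i _; apply: W_row.
  exact/fsubset_leq_card/fset_sub.
(* Summing over rows first: for each k, all but at most L^2 rows contribute at least L. *)
apply: leq_trans W_all; rewrite exchange_big /=.
rewrite -mulnA -[leqLHS](_ : \sum_(k < m) L * (r - L ^ 2) = _)%N; last first.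
  by rewrite sum_nat_const card_ord.
apply: leq_sum => k _.
have km : (k < m)%N by [].
pose bad := [set i : 'I_r |
  (count_in U 1 (cross (b i) (b i.+1) (p k.*2) (p k.+1.*2)) < L)%N].
have cbad : (#|bad| <= L ^ 2)%N.
  (* The odd point p_(2k+1) splits the cross ratio of p_2k and p_(2k+2) into two factors. *)
  apply: (@few_small_cross _ U _ (p k.*2.+1)) => //.
  - by apply: pS; lia.
  - by apply: pS; lia.
  - by apply: le_lt_trans (p_le _ _) pb; lia.
  - by move=> i ir; apply: U_cross => //; lia.
  - by move=> i ir; apply: U_cross => //; lia.
apply: (@leq_trans (\sum_(i in ~: bad) L)).
  rewrite sum_nat_const mulnC leq_mul2r; apply/orP; right.
  by have := cardsC bad; rewrite card_ord; lia.
rewrite [leqRHS](bigID (mem (~: bad))) /=; apply: leq_trans (leq_addr _ _).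
by apply: leq_sum => i; rewrite !inE -leqNgt.
Qed.

(** * Difference sets and the conclusion *)

(** A - A is symmetric, so it is covered by P, -P and 0. *)
Lemma card_diffset_pos (R : realType) (A : {fset R}) :
  (#|` diffset A A| <= #|` [fset d in diffset A A | (0 < d)%R]|.*2.+1)%N.
Proof.
set P := [fset d in _ | _].
have sub : diffset A A `<=` 0 |` (P `|` [fset - d | d in P]).
  apply/fsubsetP => d dD; rewrite in_fset1U in_fsetU.
  case: (ltgtP d 0) => [d0|d0|//] /=; apply/orP; last by left; rewrite /P !inE /= dD.
  right; apply/imfsetP; exists (- d); rewrite ?opprK //= /P !inE /= oppr_gt0 d0 andbT.
  case/imfset2P: dD => x /= xA [y /= yA ->]; rewrite opprB.
  exact: in_imfset2.
apply: leq_trans (fsubset_leq_card sub) _; rewrite cardfsU1 -add1n -addnn.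
apply: leq_add; first exact: leq_b1.
by apply: leq_trans (leq_card_fsetU _ _) _; rewrite leq_add2l leq_card_fset_image.
Qed.

Lemma card_diffset (R : realType) (A : {fset R}) :
  (#|` diffset A A| <= #|` A| ^ 2)%N.
Proof.
rewrite -mulnn -cardfs_prod.
apply: leq_trans (leq_card_fset_image (fun w => w.1 - w.2) _).
apply: fsubset_leq_card; apply/fsubsetP => _ /imfset2P[x /= xA [y /= yA ->]].
by apply/imfsetP; exists (x, y); rewrite //= in_fsetM /= xA.
Qed.

Lemma many_diff_quotients (R : realType) (A P : {fset R}) (h L : nat) :
  (forall x y, x \in A -> y \in A -> y < x -> x - y \in P) ->
  (3 * h + 1 < #|` A|)%N ->
  (h * L * (h - L ^ 2) <= #|` quotset (prodpow P 4) (prodpow P 3)|)%N.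
Proof.
move=> memP cA.
pose s := sort <=%R (enum_fset A).
have size_s : size s = #|` A| by rewrite size_sort.
have s_sorted : sorted <%R s.
  by rewrite lt_sorted_uniq_le sort_uniq fset_uniq sort_le_sorted.
have s_lt i j : (i < j < size s)%N -> nth 0 s i < nth 0 s j.
  by case/andP=> ij js; rewrite (lt_sorted_ltn_nth 0 s_sorted) // inE // (ltn_trans ij).
have s_A i : (i < size s)%N -> nth 0 s i \in A.
  by move=> /(mem_nth 0); rewrite mem_sort.
(* The sorted elements of index 0 to 2h form the lower part, those of index 2h + 1 to 3h + 1 the
   upper part. *)
apply: (@many_quotients _ P (nth 0 s) (fun i => nth 0 s (h.*2.+1 + i))).
- by move=> i j ij; apply: s_lt; lia.
- by move=> i j ij; apply: s_lt; lia.
- by apply: s_lt; lia.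
- by move=> i j ir jm; apply: memP; [apply: s_A; lia|apply: s_A; lia|apply: s_lt; lia].
Qed.

Theorem corollary6 (R : realType) (M : R) (hM : 1 <= M) :
  exists C : R, forall A : {fset R},
    let D := diffset A A in
    (#|` prodset D D|%:R <= M * #|` D|%:R) \/
    (#|` quotset D D|%:R <= M * #|` D|%:R) ->
    #|` A|%:R <= C.
Proof.
(* The 3 in [K3] comes from |D| <= 3 |P|. In [L], 128 = 2 * 8^2 comes from |A| <= 8 h and h <= 2 (h
   - L^2); [N] is chosen to force h >= 2 L^2 for h = |A| / 4. *)
pose K := Num.bound M; pose K3 := (3 * K)%N.
pose L := (128 * K3 ^ 7 + 1)%N; pose N := (8 * L ^ 2 + 8)%N.
exists N%:R => A D small; rewrite ler_nat leqNgt; apply/negP => bigA.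
pose P := [fset d in D | 0 < d].
have memP x y : x \in A -> y \in A -> y < x -> x - y \in P.
  by move=> xA yA xy; rewrite !inE /= subr_gt0 xy andbT; apply: in_imfset2.
have P_gt0 x : x \in P -> 0 < x by rewrite !inE => /andP[].
have P_D x : x \in P -> x \in D by rewrite !inE => /andP[].
have leK (n : nat) : n%:R <= M * #|` D|%:R -> (n <= K * #|` D|)%N.
  move=> le; rewrite -(ler_nat R) natrM; apply: le_trans le _.
  by rewrite ler_wpM2r //; apply/ltW/archi_boundP; apply: le_trans ler01 hM.
have A_size := ltn_trans (leq_addl _ _ : (8 <= N)%N) bigA.
have Pn0 : P != fset0.
  have /fset0Pn[x xA] : A != fset0 by rewrite -cardfs_gt0; lia.
  have /fset0Pn[y] : A `\ x != fset0.
    by rewrite -cardfs_gt0; have := cardfsD1 x A; rewrite xA; lia.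
  rewrite !inE => /andP[yx yA]; apply/fset0Pn.
  case: (ltgtP x y) yx => // xy _; first by exists (y - x); apply: memP.
  by exists (x - y); apply: memP.
have P0 : 0 \notin P by apply/negP => /P_gt0; rewrite ltxx.
have cD : (#|` D| <= 3 * #|` P|)%N.
  have cD : (#|` D| <= #|` P|.*2.+1)%N := card_diffset_pos A.
  by rewrite -cardfs_gt0 in Pn0; lia.
have cP : (#|` P| <= #|` A| ^ 2)%N.
  by apply: leq_trans (card_diffset A); apply/fsubset_leq_card/fset_sub.
have upper : (#|` quotset (prodpow P 4) (prodpow P 3)| <= K3 ^ 7 * #|` P|)%N.
  have KD : (K * #|` D| <= K3 * #|` P|)%N by rewrite /K3; nia.
  case: small => /leK small.
    apply: (@plunnecke _ P P K3 4 3) => //; apply: leq_trans (leq_trans small KD).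
    apply: fsubset_leq_card; apply/fsubsetP => _ /prodsetP[x [y [xP yP ->]]].
    by apply: prodset_mem; apply: P_D.
  (* In the quotient case P Q = P / P is small, and P^4 / P^3 = Q^3 / Q^4 has the same total
     exponent 7. *)
  pose Q := [fset x^-1 | x in P].
  apply: (@leq_trans #|` quotset (prodpow Q 3) (prodpow Q 4)|).
    apply: fsubset_leq_card; apply/fsubsetP => _ /quotsetP[x [y [xP yP y0 ->]]].
    have x0 : x != 0 by apply: contraTneq xP => ->; apply: prodpow_neq0.
    apply/quotsetP; exists y^-1, x^-1.
    by split; rewrite ?prodpow_inv ?invr_eq0 // invrK mulrC.
  apply: (@plunnecke _ P Q K3 3 4) => //.
    apply/imfsetP => -[x /= xP /esym/eqP]; rewrite invr_eq0 => /eqP x0.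
    by rewrite -x0 xP in P0.
  apply: leq_trans (leq_trans small KD).
  apply: fsubset_leq_card; apply/fsubsetP => _
    /prodsetP[x [_ [xP /imfsetP[y /= yP ->] ->]]].
  by apply/quotsetP; exists x, y; split; rewrite ?P_D // gt_eqF ?P_gt0.
pose h := (#|` A| %/ 4)%N.
have lower := @many_diff_quotients _ A P h L memP.
have h_le : (3 * h + 1 < #|` A|)%N by rewrite /h; lia.
have A_le : (#|` A| <= 8 * h)%N by rewrite /h; lia.
have h_ge : (2 * L ^ 2 <= h)%N by rewrite /h; move: bigA; rewrite /N; lia.
have h_gt0 : (0 < h)%N by rewrite /h; lia.
move: (lower h_le) => {lower}; apply/negP; rewrite -ltnNge.
apply: leq_ltn_trans upper _.
apply: (@leq_ltn_trans (K3 ^ 7 * (8 * h) ^ 2)).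
  by rewrite leq_mul2l (leq_trans cP) ?orbT // leq_exp2r.
rewrite expnMn.
apply: (@leq_trans (h * L * (h - L ^ 2))); last by [].
have : (h <= 2 * (h - L ^ 2))%N by lia.
(* Doubling both sides lets h replace 2 (h - L^2); what remains is 128 k h^2 < (128 k + 1) h^2. *)
move: (h - L ^ 2)%N => g hg; rewrite -(ltn_pmul2r (isT : 0 < 2)%N).
apply: (@leq_trans (h * L * h)); last first.
  by rewrite -[leqRHS]mulnA [(g * 2)%N]mulnC leq_mul2l hg orbT.
rewrite /L; move: (K3 ^ 7)%N => k.
have : (0 < h * h)%N by rewrite muln_gt0 h_gt0.
nia.
Qed.
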